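(* Let $F:\mathbb{R}^p\times\mathbb{R}^m\to\mathbb{R}^p$ be locally Lipschitz and path differentiable, jointly in $(x,\theta)$, and let $J_F:\mathbb{R}^p\times\mathbb{R}^m\rightrightarrows\mathbb{R}^{p\times(p+m)}$ be a conservative Jacobian for $F$. Assume there exists $0\le\rho<1$ such that for every $(x,\theta)$ and every $[A,B]\in J_F(x,\theta)$, with $A\in\mathbb{R}^{p\times p}$ and $B\in\mathbb{R}^{p\times m}$, one has $\|A\|_{\mathrm{op}}\le\rho$. Let $x_0:\mathbb{R}^m\to\mathbb{R}^p$ be Lipschitz and path differentiable with conservative Jacobian $J_{x_0}:\mathbb{R}^m\rightrightarrows\mathbb{R}^{p\times m}$. Define, for $k\in\mathbb{N}$ and $\theta\in\mathbb{R}^m$, $x_{k+1}(\theta)=F(x_k(\theta),\theta)$ and $$J_{x_{k+1}}(\theta)=\{AJ+B:\ [A,B]\in J_F(x_k(\theta),\theta),\ J\in J_{x_k}(\theta)\}.$$ Let $\bar x(\theta)$ be the unique fixed point of $F(\cdot,\theta)$ and $J^{\mathrm{pb}}_{\bar x}(\theta)=\mathrm{fix}[J_F(\bar x(\theta),\theta)]$. Then for all $\theta\in\mathbb{R}^m$, $$\lim_{k\to\infty}\mathrm{gap}\left(J_{x_k}(\theta),J^{\mathrm{pb}}_{\bar x}(\theta)\right)=0.$$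
   Context: Conservative Jacobian: for a locally Lipschitz $f:\mathbb{R}^n\to\mathbb{R}^q$, a set-valued map $J:\mathbb{R}^n\rightrightarrows\mathbb{R}^{q\times n}$ is a conservative Jacobian for $f$ if it has closed graph, is locally bounded, is nowhere empty, and for every absolutely continuous $\gamma:[0,1]\to\mathbb{R}^n$, for almost every $t\in[0,1]$, $\frac{d}{dt}f(\gamma(t))=V\dot\gamma(t)$ for all $V\in J(\gamma(t))$. $f$ is path differentiable if it admits a conservative Jacobian. $[A,B]$ is the concatenation of $A$ and $B$; $\|\cdot\|_{\mathrm{op}}$ is the operator norm induced by the Euclidean norm. The contraction hypothesis implies that $F(\cdot,\theta)$ is a strict contraction, so it has a unique fixed point. Set-valued fixed point: if $\mathcal{J}\subset\mathbb{R}^{p\times(p+m)}$ is nonempty, compact, and every $[A,B]\in\mathcal{J}$ has $\|A\|_{\mathrm{op}}\le\rho<1$, then $\mathrm{fix}(\mathcal{J})$ denotes the unique nonempty compact set $\mathcal{X}\subset\mathbb{R}^{p\times m}$ with $\mathcal{X}=\{AX+B:[A,B]\in\mathcal{J},X\in\mathcal{X}\}$. For nonempty compact sets $\mathcal{X},\mathcal{Y}$ of matrices, $\mathrm{gap}(\mathcal{X},\mathcal{Y})=\max_{X\in\mathcal{X}}\min_{Y\in\mathcal{Y}}\|X-Y\|$ with the Euclidean (Frobenius) norm. *)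

(* Defs.v *)
From HB Require Import structures.
From mathcomp Require Import all_boot all_order all_algebra.
From mathcomp Require Import all_classical all_reals all_analysis.

Set Implicit Arguments.
Unset Strict Implicit.
Unset Printing Implicit Defensive.

Import Order.TTheory GRing.Theory Num.Theory.
Import numFieldNormedType.Exports.

Local Open Scope classical_set_scope.
Local Open Scope ring_scope.

(* R^n is 'cV[R]_n and R^p x R^m is 'cV[R]_(p + m), with (x, theta) written
   col_mx x theta; a p x (p + m) matrix [A, B] is row_mx A B.  The topology
   and the norm `|_| that the library puts on matrices are those of the
   maximum norm; they are only used for notions that do not depend on the
   choice of a norm in finite dimension. *)

(* Frobenius norm; the Euclidean norm on column vectors. *)
Definition fnorm (R : realType) (m n : nat) (M : 'M[R]_(m, n)) : R :=
  Num.sqrt (\sum_i \sum_j M i j ^+ 2).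

Definition opnorm (R : realType) (m n : nat) (A : 'M[R]_(m, n)) : R :=
  sup [set fnorm (A *m x) | x in [set x : 'cV[R]_n | fnorm x <= 1]].

(* The element of P if P is a singleton, x0 otherwise. *)
Definition the (T : choiceType) (x0 : T) (P : set T) : T :=
  xget x0 [set x | unique P x].

Definition locally_lipschitz (R : realType) (n q : nat)
    (f : 'cV[R]_n -> 'cV[R]_q) : Prop :=
  forall x : 'cV[R]_n, exists2 U, nbhs x U & [lipschitz f y | y in U].

(* Absolute continuity on [0, 1]; the values of g outside [0, 1] are
   irrelevant. *)
Definition abs_continuous01 (R : realType) (n : nat)
    (g : R -> 'cV[R]_n) : Prop :=
  forall e : R, 0 < e -> exists2 d : R, 0 < d &
    forall (N : nat) (a b : 'I_N -> R),
      (forall i, [/\ 0 <= a i, a i <= b i & b i <= 1]) ->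
      trivIset setT (fun i => `]a i, b i[%classic) ->
      \sum_i (b i - a i) < d ->
      \sum_i `|g (b i) - g (a i)| < e.

(* Derivatives are two-sided, which matters only at the endpoints of [0, 1],
   a negligible set. *)
Definition conservative_jacobian (R : realType) (n q : nat)
    (f : 'cV[R]_n -> 'cV[R]_q) (J : 'cV[R]_n -> set 'M[R]_(q, n)) : Prop :=
  [/\ closed [set z : 'cV[R]_n * 'M[R]_(q, n) | J z.1 z.2],
      forall x : 'cV[R]_n, exists M : R,
        \forall y \near x, forall V, J y V -> fnorm V <= M,
      forall x, J x !=set0
    & forall g : R -> 'cV[R]_n, abs_continuous01 g ->
        {ae (@lebesgue_measure R), forall t : R, 0 <= t <= 1 ->
          derivable g t 1 /\
          forall V, J (g t) V -> is_derive t 1 (f \o g) (V *m 'D_1 g t)}].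

Definition path_differentiable (R : realType) (n q : nat)
    (f : 'cV[R]_n -> 'cV[R]_q) : Prop :=
  exists J, conservative_jacobian f J.

Definition affine_image (R : realType) (p m : nat)
    (J : set 'M[R]_(p, p + m)) (X : set 'M[R]_(p, m)) : set 'M[R]_(p, m) :=
  [set M | exists A B Y, [/\ J (row_mx A B), X Y & M = A *m Y + B]].

Definition setfix (R : realType) (p m : nat)
    (J : set 'M[R]_(p, p + m)) : set 'M[R]_(p, m) :=
  the set0 [set X | [/\ X !=set0, compact X & X = affine_image J X]].

(* The sup and inf are attained on nonempty compact sets. Extended reals make
   the gap from a nonempty set to set0 infinite rather than 0. *)
Definition gap (R : realType) (m n : nat) (X Y : set 'M[R]_(m, n)) : \bar R :=
  ereal_sup [set ereal_inf [set (fnorm (M - N))%:E | N in Y] | M in X].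

Definition fixpoint (R : realType) (p m : nat)
    (F : 'cV[R]_(p + m) -> 'cV[R]_p) (theta : 'cV[R]_m) : 'cV[R]_p :=
  the 0 [set x | F (col_mx x theta) = x].

Fixpoint iterate (R : realType) (p m : nat)
    (F : 'cV[R]_(p + m) -> 'cV[R]_p) (x0 : 'cV[R]_m -> 'cV[R]_p)
    (k : nat) (theta : 'cV[R]_m) : 'cV[R]_p :=
  if k is k'.+1 then F (col_mx (iterate F x0 k' theta) theta) else x0 theta.

Fixpoint iterate_jacobian (R : realType) (p m : nat)
    (F : 'cV[R]_(p + m) -> 'cV[R]_p)
    (JF : 'cV[R]_(p + m) -> set 'M[R]_(p, p + m))
    (x0 : 'cV[R]_m -> 'cV[R]_p) (Jx0 : 'cV[R]_m -> set 'M[R]_(p, m))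
    (k : nat) (theta : 'cV[R]_m) : set 'M[R]_(p, m) :=
  if k is k'.+1 then
    affine_image (JF (col_mx (iterate F x0 k' theta) theta))
                 (iterate_jacobian F JF x0 Jx0 k' theta)
  else Jx0 theta.

(* Main.v *)
Require Import Defs.
From mathcomp Require Import all_boot all_order all_algebra.
From mathcomp Require Import all_classical all_reals all_analysis.
From mathcomp Require Import measurable_realfun ring lra.

(* Along a segment the chain rule for the conservative Jacobian bounds the speed
   of F almost everywhere, so F(., theta) is a rho-contraction in the Euclidean
   norm and x_k(theta) converges to the fixed point.  A closed graph and local
   boundedness make J_F upper semicontinuous: for large k every element of
   J_F(x_k(theta), theta) is within e of J_F(xbar(theta), theta).  If d bounds
   the distance from J_{x_k}(theta) to X = fix(J_F(xbar(theta), theta)), then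
   rho d + e (max_X ||.|| + 1) bounds the one from J_{x_{k+1}}(theta), and
   iterating this makes the gap arbitrarily small. *)

Set Implicit Arguments.
Unset Strict Implicit.
Unset Printing Implicit Defensive.

Import Order.TTheory GRing.Theory Num.Theory.
Import numFieldNormedType.Exports.

Local Open Scope classical_set_scope.
Local Open Scope ring_scope.

(** * The Frobenius norm *)

Section FrobeniusNorm.
Context {R : realType}.

(** Cauchy-Schwarz: in the notation of the proof, [B * (A * B - D ^+ 2)] is a sum of squares, and
    [B = 0] forces every [b i] to vanish. *)
Lemma sum_mul_sqr_le (I : finType) (a b : I -> R) :
  (\sum_i a i * b i) ^+ 2 <= (\sum_i a i ^+ 2) * (\sum_i b i ^+ 2).
Proof.
set D := \sum_i a i * b i; set A := \sum_i a i ^+ 2; set B := \sum_i b i ^+ 2.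
have B_ge0 : 0 <= B by apply: sumr_ge0 => i _; exact: sqr_ge0.
have [B0|B_neq0] := eqVneq B 0.
  have b0 i : b i = 0.
    apply/eqP; rewrite -sqrf_eq0; apply/eqP; move: i isT.
    by apply: psumr_eq0P B0 => i _; exact: sqr_ge0.
  by rewrite /D big1 ?expr0n ?B0 ?mulr0// => i _; rewrite b0 mulr0.
have B_gt0 : 0 < B by rewrite lt_def B_neq0.
rewrite -(ler_pM2l B_gt0) -subr_ge0.
have -> : B * (A * B) - B * D ^+ 2 = \sum_i (B * a i - D * b i) ^+ 2.
  have sqrE i : (B * a i - D * b i) ^+ 2 = B ^+ 2 * a i ^+ 2 +
    (- (2 * B * D)) * (a i * b i) + D ^+ 2 * b i ^+ 2 by ring.
  rewrite (eq_bigr _ (fun i _ => sqrE i)).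
  by rewrite !big_split/= -!mulr_sumr -/A -/B -/D; ring.
by apply: sumr_ge0 => i _; exact: sqr_ge0.
Qed.

Lemma fnorm_sqr (m n : nat) (M : 'M[R]_(m, n)) :
  fnorm M ^+ 2 = \sum_(ij : 'I_m * 'I_n) M ij.1 ij.2 ^+ 2.
Proof.
rewrite /fnorm pair_bigA sqr_sqrtr//.
by apply: sumr_ge0 => ? _; exact: sqr_ge0.
Qed.

Lemma fnorm_sqr2 (m n : nat) (M : 'M[R]_(m, n)) :
  fnorm M ^+ 2 = \sum_i \sum_j M i j ^+ 2.
Proof. by rewrite fnorm_sqr pair_bigA. Qed.

Lemma fnorm_ge0 (m n : nat) (M : 'M[R]_(m, n)) : 0 <= fnorm M.
Proof. exact: sqrtr_ge0. Qed.
Hint Resolve fnorm_ge0 : core.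

Lemma fnormD (m n : nat) (M N : 'M[R]_(m, n)) :
  fnorm (M + N) <= fnorm M + fnorm N.
Proof.
rewrite -(@ler_pXn2r _ 2)// ?nnegrE ?addr_ge0// sqrrD -mulr_natl !fnorm_sqr.
under eq_bigr do rewrite mxE sqrrD -mulr_natl.
rewrite !big_split/= lerD2r lerD2l -mulr_sumr ler_pM2l//.
apply: le_trans (ler_norm _) _.
rewrite -(@ler_pXn2r _ 2)// ?nnegrE ?mulr_ge0// real_normK ?num_real//.
by rewrite exprMn !fnorm_sqr; exact: sum_mul_sqr_le.
Qed.

Lemma fnormZ (m n : nat) a (M : 'M[R]_(m, n)) : fnorm (a *: M) = `|a| * fnorm M.
Proof.
apply/eqP; rewrite -(@eqrXn2 _ 2)// ?mulr_ge0// exprMn real_normK ?num_real//.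
by rewrite !fnorm_sqr mulr_sumr; apply/eqP/eq_bigr => i _; rewrite mxE exprMn.
Qed.

Lemma fnormN (m n : nat) (M : 'M[R]_(m, n)) : fnorm (- M) = fnorm M.
Proof. by rewrite -scaleN1r fnormZ normrN1 mul1r. Qed.

Lemma fnorm0 (m n : nat) : fnorm (0 : 'M[R]_(m, n)) = 0.
Proof. by rewrite -(scale0r 0) fnormZ normr0 mul0r. Qed.

Lemma fnorm_distC (m n : nat) (M N : 'M[R]_(m, n)) :
  fnorm (M - N) = fnorm (N - M).
Proof. by rewrite -fnormN opprB. Qed.

Lemma fnorm_dist_triangle (m n : nat) (N M P : 'M[R]_(m, n)) :
  fnorm (M - P) <= fnorm (M - N) + fnorm (N - P).
Proof. by apply: le_trans (fnormD _ _); rewrite addrA subrK. Qed.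

Lemma fnorm_le_add_dist (m n : nat) (M N : 'M[R]_(m, n)) :
  fnorm M <= fnorm N + fnorm (M - N).
Proof. by apply: le_trans (fnormD _ _); rewrite addrC subrK. Qed.

Lemma entry_le_fnorm (m n : nat) (M : 'M[R]_(m, n)) i j : `|M i j| <= fnorm M.
Proof.
rewrite -(@ler_pXn2r _ 2)// ?nnegrE// real_normK ?num_real//.
rewrite fnorm_sqr (bigD1 (i, j))//= lerDl.
by apply: sumr_ge0 => ? _; exact: sqr_ge0.
Qed.

Lemma fnorm0_eq0 (m n : nat) (M : 'M[R]_(m, n)) : fnorm M = 0 -> M = 0.
Proof.
move=> M0; apply/matrixP => i j; rewrite mxE; apply/eqP.
by rewrite -normr_le0 -M0 entry_le_fnorm.
Qed.

Lemma norm_le_fnorm (m n : nat) (M : 'M[R]_(m, n)) : `|M| <= fnorm M.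
Proof.
rewrite [leLHS]mx_normrE; apply: bigmax_le => // ij _.
exact: entry_le_fnorm.
Qed.

Lemma entry_le_norm (m n : nat) (M : 'M[R]_(m, n)) i j : `|M i j| <= `|M|.
Proof.
rewrite [leRHS]mx_normrE.
exact: (le_bigmax _ (fun ij : 'I_m * 'I_n => `|M ij.1 ij.2|) (i, j)).
Qed.

(** Bounding each squared entry gives the factor [sqrt (m * n)], relaxed to [m * n] because
    [k <= k ^ 2] for natural [k]. *)
Lemma fnorm_le_norm (m n : nat) (M : 'M[R]_(m, n)) :
  fnorm M <= (m * n)%:R * `|M|.
Proof.
rewrite -(@ler_pXn2r _ 2)// ?nnegrE ?mulr_ge0// fnorm_sqr.
apply: (@le_trans _ _ (\sum_(ij : 'I_m * 'I_n) `|M| ^+ 2)).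
  apply: ler_sum => ij _; rewrite -[leLHS]real_normK ?num_real//.
  by rewrite ler_pXn2r ?nnegrE// entry_le_norm.
rewrite sumr_const card_prod !card_ord exprMn -[leLHS]mulr_natl.
rewrite ler_wpM2r ?sqr_ge0// -natrX ler_nat.
by case: (m * n)%N => // k; rewrite leq_pmulr.
Qed.

Lemma fnorm_mulmx (m n p : nat) (A : 'M[R]_(m, n)) (B : 'M[R]_(n, p)) :
  fnorm (A *m B) <= fnorm A * fnorm B.
Proof.
rewrite -(@ler_pXn2r _ 2)// ?nnegrE ?mulr_ge0// exprMn !fnorm_sqr2.
rewrite [X in _ * X]exchange_big/=.
rewrite mulr_suml; apply: ler_sum => i _; rewrite mulr_sumr.
by apply: ler_sum => j _; rewrite mxE; exact: sum_mul_sqr_le.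
Qed.

Lemma fnorm_row_mx_sqr (m n1 n2 : nat) (A : 'M[R]_(m, n1)) (B : 'M[R]_(m, n2)) :
  fnorm (row_mx A B) ^+ 2 = fnorm A ^+ 2 + fnorm B ^+ 2.
Proof.
rewrite !fnorm_sqr2 -big_split/=; apply: eq_bigr => i _.
by rewrite big_split_ord/=; congr (_ + _); apply: eq_bigr => j _;
  rewrite ?row_mxEl ?row_mxEr.
Qed.

Lemma fnorm_row_mxl (m n1 n2 : nat) (A : 'M[R]_(m, n1)) (B : 'M[R]_(m, n2)) :
  fnorm A <= fnorm (row_mx A B).
Proof.
by rewrite -(@ler_pXn2r _ 2)// ?nnegrE// fnorm_row_mx_sqr lerDl sqr_ge0.
Qed.

Lemma fnorm_row_mxr (m n1 n2 : nat) (A : 'M[R]_(m, n1)) (B : 'M[R]_(m, n2)) :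
  fnorm B <= fnorm (row_mx A B).
Proof.
by rewrite -(@ler_pXn2r _ 2)// ?nnegrE// fnorm_row_mx_sqr lerDr sqr_ge0.
Qed.

Lemma fnorm_col_mx0 (m1 m2 n : nat) (A : 'M[R]_(m1, n)) :
  fnorm (col_mx A (0 : 'M[R]_(m2, n))) = fnorm A.
Proof.
apply/eqP; rewrite -(@eqrXn2 _ 2)// !fnorm_sqr2 big_split_ord/=.
rewrite [X in _ + X]big1 => [|i _]; last first.
  by rewrite big1// => j _; rewrite col_mxEd mxE expr0n.
rewrite addr0; apply/eqP/eq_bigr => i _; apply: eq_bigr => j _.
by rewrite col_mxEu.
Qed.

Lemma fnorm_mul_opnorm_cV (m n : nat) (A : 'M[R]_(m, n)) (x : 'cV[R]_n) :
  fnorm (A *m x) <= opnorm A * fnorm x.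
Proof.
have [x0|x_neq0] := eqVneq (fnorm x) 0.
  by rewrite (fnorm0_eq0 x0) mulmx0 !fnorm0 mulr0.
have x_gt0 : 0 < fnorm x by rewrite lt_def x_neq0 fnorm_ge0.
rewrite -ler_pdivrMr//.
have -> : fnorm (A *m x) / fnorm x = fnorm (A *m ((fnorm x)^-1 *: x)).
  by rewrite -scalemxAr fnormZ gtr0_norm ?invr_gt0// mulrC.
apply: ub_le_sup.
  (* The supremum defining [opnorm] is finite: [fnorm A] bounds the set. *)
  exists (fnorm A) => _ [y /= y1 <-]; apply: le_trans (fnorm_mulmx _ _) _.
  by rewrite ler_piMr.
exists ((fnorm x)^-1 *: x) => //=.
by rewrite fnormZ gtr0_norm ?invr_gt0// mulVf.
Qed.

(** The squared Frobenius norm is the sum of the squared Euclidean norms of the columns, and the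
    bound holds on each column. *)
Lemma fnorm_mul_le (m n p : nat) (A : 'M[R]_(m, n)) (M : 'M[R]_(n, p)) (c : R) :
  opnorm A <= c -> fnorm (A *m M) <= c * fnorm M.
Proof.
move=> Ac.
have Acx (x : 'cV[R]_n) : fnorm (A *m x) <= c * fnorm x.
  by apply: le_trans (fnorm_mul_opnorm_cV _ _) _; rewrite ler_wpM2r.
have [->|M_neq0] := eqVneq M 0; first by rewrite mulmx0 !fnorm0 mulr0.
(* If [c] were negative, every column of [M] would have norm at most 0, contradicting [M != 0]. *)
have c_ge0 : 0 <= c.
  have [//|c_lt0] := leP 0 c.
  have /eqP[] := M_neq0; apply/matrixP => i j; rewrite mxE.
  have : fnorm (col j M) = 0.
    apply: le_anti; rewrite fnorm_ge0 andbT -(nmulr_rge0 _ c_lt0).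
    exact: le_trans (Acx _).
  by move=> /fnorm0_eq0/colP/(_ i); rewrite !mxE.
rewrite -(@ler_pXn2r _ 2)// ?nnegrE ?mulr_ge0// exprMn !fnorm_sqr2.
rewrite exchange_big/= [X in _ * X]exchange_big/= mulr_sumr.
apply: ler_sum => j _.
have : fnorm (A *m col j M) ^+ 2 <= (c * fnorm (col j M)) ^+ 2.
  by rewrite ler_pXn2r ?nnegrE ?mulr_ge0.
rewrite exprMn !fnorm_sqr2 => Mj.
rewrite (eq_bigr (fun i => \sum_(k < 1) (A *m col j M) i k ^+ 2)); last first.
  move=> i _; rewrite big_ord1 !mxE; congr (_ ^+ 2).
  by apply: eq_bigr => k _; rewrite !mxE.
rewrite [X in _ * X](eq_bigr (fun i => \sum_(k < 1) col j M i k ^+ 2))//.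
by move=> i _; rewrite big_ord1 !mxE.
Qed.

(** Equivalence of the two norms: the topology of the maximum norm can be handled through Frobenius
    balls. *)
Lemma fnorm_nbhsP (m n : nat) (M : 'M[R]_(m, n)) (U : set 'M[R]_(m, n)) :
  nbhs M U <-> exists2 e : R, 0 < e & forall N, fnorm (M - N) < e -> U N.
Proof.
split=> [/nbhs_normP[e /= e_gt0 eU]|[e e_gt0 eU]].
  by exists e => // N MN; apply: eU; exact: le_lt_trans (norm_le_fnorm _) MN.
apply/(nbhs_normP (M : 'M[R]_(m, n))); exists (e / ((m * n)%:R + 1)) => /=.
  by rewrite divr_gt0.
move=> N /= MN; apply: eU; apply: le_lt_trans (fnorm_le_norm _) _.
apply: (@le_lt_trans _ _ (((m * n)%:R + 1) * `|M - N|)).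
  by rewrite ler_wpM2r// lerDl.
by rewrite mulrC -ltr_pdivlMr.
Qed.

Lemma near_fnorm_dist (m n : nat) (M : 'M[R]_(m, n)) (e : R) :
  0 < e -> \forall N \near M, fnorm (M - N) < e.
Proof. by move=> e_gt0; apply/fnorm_nbhsP; exists e. Qed.

Lemma cvg_fnormP (m n : nat) (T : Type) (G : set_system T) (f : T -> 'M[R]_(m, n))
    (M : 'M[R]_(m, n)) :
  Filter G ->
  (forall e : R, 0 < e -> \forall t \near G, fnorm (M - f t) < e) <->
  f @ G --> M.
Proof.
move=> GF; split=> [h U /fnorm_nbhsP[e e_gt0 eU]|fM e e_gt0].
  by have := h _ e_gt0; apply: filterS => t /eU.
exact: (fM [set N | fnorm (M - N) < e] (near_fnorm_dist M e_gt0)).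
Qed.

Lemma continuous_fnorm (m n : nat) : continuous (@fnorm R m n).
Proof.
move=> M; apply/cvgrPdist_lt; first exact: nbhs_filter.
move=> e e_gt0; have := near_fnorm_dist M e_gt0; apply: filterS => N MN.
rewrite ltr_norml; have := fnorm_le_add_dist M N.
have := fnorm_le_add_dist N M; rewrite (fnorm_distC N) => h1 h2.
by apply/andP; split; lra.
Qed.

(** The ball is a closed subset of the image, under the continuous map [vec_mx], of a closed bounded
    set of row vectors, which is compact. *)
Lemma compact_fnorm_ball (m n : nat) (r : R) :
  compact [set M : 'M[R]_(m, n) | fnorm M <= r].
Proof.
have vec_cont : continuous (@vec_mx R m n).
  move=> v; apply/cvgrPdist_lt; first exact: nbhs_filter.
  move=> e e_gt0; have := near_fnorm_dist v e_gt0.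
  apply: filterS => w; apply: le_lt_trans.
  rewrite -linearB/= [leLHS]mx_normrE; apply: bigmax_le => [|ij _].
    exact: fnorm_ge0.
  by rewrite mxE entry_le_fnorm.
apply: (@subclosed_compact _ _
    (@vec_mx R m n @` [set v | `|v| <= r])).
- apply: (@closed_comp _ _ (@fnorm R m n) [set x | x <= r]) => [M _|];
    [exact: continuous_fnorm|exact: closed_le].
- apply: continuous_compact; first exact: continuous_subspaceT.
  apply: bounded_closed_compact.
    exists r; split => [|x rx v /= vr]; first exact: num_real.
    exact: le_trans vr (ltW rx).
  apply: (@closed_comp _ _ (@Num.norm R 'rV[R]_(m * n)) [set x | x <= r])
    => [v _|]; [exact: norm_continuous|exact: closed_le].
- move=> M /= Mr; exists (mxvec M); last exact: mxvecK.
  rewrite /= [leLHS]mx_normrE; apply: bigmax_le => [|[i k] _].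
    exact: le_trans Mr.
  case/mxvec_indexP: k => a b.
  rewrite /= (ord1 i) mxvecE; apply: le_trans Mr; exact: entry_le_fnorm.
Qed.

Lemma compact_of_fnorm_bounded (m n : nat) (r : R) (X : set 'M[R]_(m, n)) :
  closed X -> (forall M, X M -> fnorm M <= r) -> compact X.
Proof.
move=> clX Xr; apply: subclosed_compact clX (@compact_fnorm_ball m n r) _.
exact: Xr.
Qed.

Lemma compact_fnorm_bounded (m n : nat) (X : set 'M[R]_(m, n)) :
  compact X -> exists r : R, forall M, X M -> fnorm M <= r.
Proof.
move=> /compact_bounded[r [_ rX]]; exists ((m * n)%:R * (r + 1)) => M XM.
apply: le_trans (fnorm_le_norm _) _; rewrite ler_wpM2l//.
by apply: rX XM; rewrite ltrDl.
Qed.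

End FrobeniusNorm.

(** * A mean value inequality for almost everywhere derivatives *)

Section MeanValueInequality.
Context {R : realType}.

(** Let [T] collect the [t] up to which [P] holds throughout. The left hypothesis gives [P] at
    [sup T]; the right one would push [T] past its supremum if that were below [b]. *)
Lemma real_induction (a b : R) (P : R -> Prop) :
  a <= b -> P a ->
  (forall t, a <= t < b -> P t ->
    exists2 d, 0 < d & forall s, t <= s <= b -> s < t + d -> P s) ->
  (forall t, a < t <= b -> (forall s, a <= s < t -> P s) -> P t) ->
  P b.
Proof.
move=> ab Pa Pright Pleft.
pose T := [set t : R | a <= t <= b /\ forall s, a <= s <= t -> P s].
have Ta : T a.
  by split=> [|s]; [rewrite lexx ab|rewrite -eq_le => /eqP <-].
have ubT : ubound T b by move=> t [/andP[]].
have hsT : has_sup T by split; [exists a|exists b].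
have ac : a <= sup T by apply: ub_le_sup Ta; case: hsT.
have cb : sup T <= b by apply: ge_sup ubT; exists a.
have Plt s : a <= s < sup T -> P s.
  move=> /andP[as_ sc]; have [t [_ Tt] st] := sup_gt (proj1 hsT) sc.
  by apply: Tt; rewrite as_ ltW.
have Pc : P (sup T).
  have [<-//|a_neq] := eqVneq a (sup T).
  by apply: Pleft; [rewrite lt_neqAle a_neq ac|exact: Plt].
have [cb'|] := ltP (sup T) b; last first.
  by move=> bc; have <- : sup T = b by apply/le_anti/andP.
have [|d d_gt0 Pd] := Pright _ _ Pc; first by rewrite ac.
(* Halving [d] keeps the whole segment from [sup T] to [s] strictly below [sup T + d]. *)
pose s := Num.min b (sup T + d / 2).
have cs : sup T < s by rewrite lt_min cb' ltrDl divr_gt0.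
suff Ts : T s by have := ub_le_sup (proj2 hsT) Ts; rewrite leNgt cs.
split=> [|u /andP[au us]].
  by rewrite (le_trans ac (ltW cs)) ge_min lexx.
have [uc|cu] := ltP u (sup T); first by apply: Plt; rewrite au.
apply: Pd; first by rewrite cu (le_trans us)// ge_min lexx.
apply: le_lt_trans us _; rewrite gt_min; apply/orP; right.
by rewrite ltrD2l; lra.
Qed.

Notation mu := (@lebesgue_measure R).

(** Outer regularity, applied to a measurable null set containing [N]. *)
Lemma negligible_open_cover (N : set R) (e : R) : mu.-negligible N -> 0 < e ->
  exists U : set R, [/\ open U, N `<=` U & (mu U < e%:E)%E].
Proof.
move=> [N' [mN' N'0 NN']] e_gt0.
have [|U [oU N'U UN']] := lebesgue_regularity_outer mN' _ e_gt0.
  by rewrite [ltLHS]N'0 ltry.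
exists U; split=> //; first exact: subset_trans N'U.
have mU : measurable U by exact: open_measurable.
rewrite (_ : U = N' `|` (U `\` N')); last by rewrite setDUK.
apply: le_lt_trans (measureU2 _ _ _) _ => //; first exact: measurableD.
by rewrite [X in (X + _)%E]N'0 add0e.
Qed.

(* Real induction on [fnorm (f t - f a) <= (c + e) (t - a) + L h t], where [h t] is
   the measure of [U] before [t] for a small open cover [U] of the exceptional
   set: outside [N] the derivative absorbs the increment, inside [U] the
   Lipschitz bound is paid for by the growth of [h]. *)
Lemma ae_speed_le_lipschitz (m n : nat) (f : R -> 'M[R]_(m, n)) (a b c L : R)
    (N : set R) :
  a <= b -> 0 <= c -> 0 <= L ->
  (forall s t, a <= s <= b -> a <= t <= b ->
    fnorm (f s - f t) <= L * `|s - t|) ->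
  mu.-negligible N ->
  (forall t, a <= t <= b -> ~ N t -> forall e, 0 < e ->
    \forall s \near t, fnorm (f s - f t) <= (c + e) * `|s - t|) ->
  fnorm (f b - f a) <= c * (b - a).
Proof.
move=> ab c_ge0 L_ge0 fL N0 fN; apply/ler_addgt0Pr => e0 e0_gt0.
(* Chosen so that the final excess [e * (b - a) + L * e] is at most [e0]; the added 1 keeps the
   denominator positive. *)
pose e := e0 / (b - a + L + 1).
have den_gt0 : 0 < b - a + L + 1 by lra.
have e_gt0 : 0 < e by rewrite divr_gt0.
have [U [oU NU Ue]] := negligible_open_cover N0 e_gt0.
have mU : measurable U by exact: open_measurable.
pose h t := fine (mu (U `&` `]-oo, t])).
have mUt t : measurable (U `&` `]-oo, t]) by exact: measurableI.
have le_mu (A B : set R) : measurable A -> measurable B -> A `<=` B ->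
    (mu A <= mu B)%E.
  by move=> mA mB AB; apply: le_measure; rewrite ?inE.
have hfin t : mu (U `&` `]-oo, t]) \is a fin_num.
  rewrite ge0_fin_numE//; apply: le_lt_trans (ltry e).
  exact: le_trans (le_mu _ _ (mUt t) mU (@subIsetl _ _ _)) (ltW Ue).
have h_ge0 t : 0 <= h t by exact: fine_ge0.
have h_le s t : s <= t -> h s <= h t.
  move=> st; rewrite fine_le//; apply: le_mu (mUt s) (mUt t) _.
  by apply: setIS => x /=; rewrite !in_itv/= => /le_trans; exact.
have h_lt t : h t <= e.
  rewrite -lee_fin fineK//.
  exact: le_trans (le_mu _ _ (mUt t) mU (@subIsetl _ _ _)) (ltW Ue).
(* Inside [U] the function [h] grows at least at unit rate, since []s, t]] is disjoint from the part
   of [U] counted by [h s]. *)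
have hU s t : s <= t -> `[s, t] `<=` U -> h s + (t - s) <= h t.
  move=> st stU; rewrite -lee_fin EFinD !fineK//.
  have -> : (t - s)%:E = mu `]s, t]%classic.
    rewrite lebesgue_measure_itv/= lte_fin; case: ltgtP st => // -> _.
    by rewrite subrr.
  rewrite -measureU; [|exact: mUt|by []|].
    apply: le_mu (measurableU _ _ (mUt s) _) (mUt t) _ => // x [[Ux /=]|/=].
      by rewrite !in_itv/= => xs; split=> //; exact: le_trans st.
    rewrite !in_itv/= => /andP[sx xt]; split=> //.
    by apply: stU; rewrite /= in_itv/= (ltW sx).
  apply/seteqP; split=> // x [[_ /=]]; rewrite !in_itv/= => xs /andP[].
  by rewrite ltNge xs.
pose P t := fnorm (f t - f a) <= (c + e) * (t - a) + L * h t.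
suff Pb : P b.
  apply: le_trans Pb _.
  have : L * h b <= L * e by rewrite ler_wpM2l.
  have : e * (b - a + L + 1) = e0 by rewrite divfK// gt_eqF.
  by nra.
apply: (@real_induction a b P) => //.
- by rewrite /P !subrr fnorm0 mulr0 add0r mulr_ge0.
- move=> t /andP[at_ tb] Pt.
  have [Nt|Nt] := pselect (N t).
    have /nbhs_ballP[d /= d_gt0 dU] : nbhs t U.
      by apply: open_nbhs_nbhs; split=> //; exact: NU.
    exists d => // s /andP[ts sb] sd; rewrite /P.
    have hst : h t + (s - t) <= h s.
      apply: hU => // x /=; rewrite in_itv/= => /andP[tx xs]; apply: dU.
      by rewrite /ball/= ltr_norml; apply/andP; split; lra.
    apply: le_trans (fnorm_dist_triangle (f t) _ _) _.
    have := fL s t; rewrite (le_trans at_ ts) sb at_ (ltW tb) => /(_ isT isT).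
    rewrite ger0_norm ?subr_ge0// => fst.
    have : L * (h t + (s - t)) <= L * h s by rewrite ler_wpM2l.
    by move: Pt; rewrite /P; nra.
  have := fN t _ Nt e e_gt0; rewrite at_ (ltW tb) => /(_ isT).
  move=> /nbhs_ballP[d /= d_gt0 fd].
  exists d => // s /andP[ts sb] sd; rewrite /P.
  apply: le_trans (fnorm_dist_triangle (f t) _ _) _.
  have /fd : ball t d s by rewrite /ball/= ltr_norml; apply/andP; split; lra.
  rewrite ger0_norm ?subr_ge0// => fst.
  have : L * h t <= L * h s by rewrite ler_wpM2l// h_le.
  by move: Pt; rewrite /P; nra.
- move=> t /andP[at_ tb] Ps; rewrite /P; apply/ler_addgt0Pr => r r_gt0.
  (* Close enough to [t] that the Lipschitz increment [L * (t - s)] fits in the slack [r]; [L + 1]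
     avoids dividing by 0. *)
  pose s := Num.max a (t - r / (L + 1)).
  have L1_gt0 : 0 < L + 1 by lra.
  have q_gt0 : 0 < r / (L + 1) by rewrite divr_gt0.
  have qE : r / (L + 1) * (L + 1) = r by rewrite divfK// gt_eqF.
  have as_ : a <= s by rewrite le_max lexx.
  have st : s < t by rewrite gt_max at_/=; lra.
  have ts : t - s <= r / (L + 1).
    by rewrite lerBlDr -lerBlDl le_max lexx orbT.
  apply: le_trans (fnorm_dist_triangle (f s) _ _) _.
  have := fL t s; rewrite (ltW at_) tb as_ (le_trans (ltW st) tb).
  move=> /(_ isT isT).
  rewrite gtr0_norm ?subr_gt0// => fts.
  have := Ps s; rewrite as_ st => /(_ isT); rewrite /P => Pss.
  have : L * h s <= L * h t by rewrite ler_wpM2l// h_le// ltW.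
  have : L * (t - s) <= L * (r / (L + 1)) by rewrite ler_wpM2l.
  by nra.
Qed.

(** The bound [c * (b - a)] does not involve the Lipschitz constant, so local constants suffice: a
    second real induction glues the estimates on short intervals. *)
Lemma ae_speed_le (m n : nat) (f : R -> 'M[R]_(m, n)) (a b c : R) (N : set R) :
  a <= b -> 0 <= c ->
  (forall t, a <= t <= b -> exists L d : R, [/\ 0 <= L, 0 < d &
    forall s s', `|s - t| < d -> `|s' - t| < d ->
      fnorm (f s - f s') <= L * `|s - s'|]) ->
  mu.-negligible N ->
  (forall t, a <= t <= b -> ~ N t -> forall e, 0 < e ->
    \forall s \near t, fnorm (f s - f t) <= (c + e) * `|s - t|) ->
  fnorm (f b - f a) <= c * (b - a).
Proof.
move=> ab c_ge0 fL N0 fN.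
apply: (@real_induction a b (fun t => fnorm (f t - f a) <= c * (t - a))) => //.
- by rewrite !subrr fnorm0 mulr0.
- move=> t /andP[at_ tb] Pt.
  have [|L [d [L_ge0 d_gt0 fd]]] := fL t; first by rewrite at_ ltW.
  exists d => // s /andP[ts sb] sd.
  have : fnorm (f s - f t) <= c * (s - t).
    apply: (ae_speed_le_lipschitz (L := L) (N := N)) => //.
      move=> u v /andP[tu us] /andP[tv vs].
      by apply: fd; rewrite ger0_norm; lra.
    move=> u /andP[tu us]; apply: fN.
    by rewrite (le_trans at_ tu) (le_trans us).
  have := fnorm_dist_triangle (f t) (f s) (f a).
  by nra.
- move=> t /andP[at_ tb] Ps.
  have [|L [d [L_ge0 d_gt0 fd]]] := fL t; first by rewrite tb ltW.
  pose s := Num.max a (t - d / 2).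
  have as_ : a <= s by rewrite le_max lexx.
  have st : s < t by rewrite gt_max at_/=; lra.
  have ts : t - s <= d / 2 by rewrite lerBlDr -lerBlDl le_max lexx orbT.
  have : fnorm (f t - f s) <= c * (t - s).
    apply: (ae_speed_le_lipschitz (L := L) (N := N)) => //; first exact: ltW.
      move=> u v /andP[su ut] /andP[sv vt].
      by apply: fd; rewrite ler0_norm; lra.
    move=> u /andP[su ut]; apply: fN.
    by rewrite (le_trans as_ su) (le_trans ut).
  have := Ps s; rewrite as_ st => /(_ isT).
  have := fnorm_dist_triangle (f s) (f t) (f a).
  by nra.
Qed.

End MeanValueInequality.

(** * Mean value inequality along segments for conservative Jacobians *)

Section ConservativeMeanValue.
Context {R : realType} {n q : nat}.

Lemma locally_lipschitz_fnorm (f : 'cV[R]_n -> 'cV[R]_q) (x : 'cV[R]_n) :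
  locally_lipschitz f -> exists L d : R, [/\ 0 <= L, 0 < d &
    forall y z, fnorm (x - y) < d -> fnorm (x - z) < d ->
      fnorm (f y - f z) <= L * fnorm (y - z)].
Proof.
move=> /(_ x)[U /fnorm_nbhsP[d d_gt0 dU] fU].
(* Lipschitz continuity is stated for all large constants, so a nonnegative one can be picked. *)
have [k [k_ge0 kf]] : exists k : R, 0 <= k /\ k.-lipschitz_U f.
  near (+oo_R : set_system R) => k; exists k; split; near: k => //.
  exact: nbhs_pinfty_ge.
exists ((q * 1)%:R * k), d; split=> //; first by rewrite mulr_ge0.
move=> y z xy xz; apply: le_trans (fnorm_le_norm _) _.
rewrite -mulrA ler_wpM2l//; apply: (@le_trans _ _ (k * `|y - z|)).
  by apply: (kf (y, z)); split; exact: dU.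
by rewrite ler_wpM2l// norm_le_fnorm.
Unshelve. all: by end_near. Qed.

Let line (x y : 'cV[R]_n) (t : R) := x + t *: (y - x).

Lemma abs_continuous01_line (x y : 'cV[R]_n) : abs_continuous01 (line x y).
Proof.
move=> e e_gt0; exists (e / (`|y - x| + 1)).
  by rewrite divr_gt0// ltr_wpDl.
move=> N a b ab _; rewrite ltr_pdivlMr ?ltr_wpDl//; apply: le_lt_trans.
rewrite mulr_suml; apply: ler_sum => i _; have [_ aib _] := ab i.
rewrite /line opprD addrACA subrr add0r -scalerBl normrZ.
by rewrite ger0_norm ?subr_ge0// ler_wpM2l ?subr_ge0// lerDl.
Qed.

Lemma is_derive_line (x y : 'cV[R]_n) (t : R) :
  is_derive t (1 : R) (line x y) (y - x).
Proof.
suff h : (fun h : R => h^-1 *: ((line x y \o shift t) (h *: 1) - line x y t))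
    @ 0^' --> y - x.
  by split; [apply/cvg_ex; exists (y - x)|exact: cvg_lim h].
apply: cvg_near_cst; near=> h.
have h_neq0 : h != 0 by near: h; exact: nbhs_dnbhs_neq.
rewrite /line /= opprD addrACA subrr add0r -scalerBl /GRing.scale/= mulr1 addrK.
by rewrite -/(GRing.scale _ _) scalerA mulVf// scale1r.
Unshelve. all: by end_near. Qed.

(** Along the segment, [f] has derivative [V *m (y - x)] at almost every time, hence speed at most
    [c]; [ae_speed_le] on [[0, 1]] concludes. *)
Lemma conservative_mean_value (f : 'cV[R]_n -> 'cV[R]_q)
    (J : 'cV[R]_n -> set 'M[R]_(q, n)) (x y : 'cV[R]_n) (c : R) :
  locally_lipschitz f -> conservative_jacobian f J -> 0 <= c ->
  (forall t V, J (x + t *: (y - x)) V -> fnorm (V *m (y - x)) <= c) ->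
  fnorm (f y - f x) <= c.
Proof.
move=> f_lip [_ _ J_neq0 J_chain] c_ge0 Jc.
have /J_chain ae_chain := abs_continuous01_line x y.
have -> : f y - f x = (f \o line x y) 1 - (f \o line x y) 0.
  by rewrite /= /line scale1r scale0r addr0 (addrC x) subrK.
rewrite -[leRHS]mulr1 -[X in _ * X](subr0 1).
(* The set where the chain rule fails serves as the negligible set [N]; [contrapT] recovers the
   chain rule off it. *)
apply: (ae_speed_le _ c_ge0 _ ae_chain) => // [t _|t t01 /contrapT ae_t e e_gt0].
  have [L [d [L_ge0 d_gt0 fd]]] := locally_lipschitz_fnorm (line x y t) f_lip.
  pose k := fnorm (y - x).
  have k1_gt0 : 0 < k + 1 by rewrite ltr_wpDl// fnorm_ge0.
  have lineB s s' : fnorm (line x y s - line x y s') = `|s - s'| * k.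
    by rewrite /line opprD addrACA subrr add0r -scalerBl fnormZ.
  have dist s : `|s - t| < d / (k + 1) -> fnorm (line x y t - line x y s) < d.
    rewrite lineB distrC ltr_pdivlMr//; apply: le_lt_trans.
    by rewrite ler_wpM2l// lerDl.
  exists (L * k), (d / (k + 1)); split.
  - by rewrite mulr_ge0 ?fnorm_ge0.
  - by rewrite divr_gt0.
  - move=> s s' /dist ds /dist ds'; apply: le_trans (fd _ _ ds ds') _.
    by rewrite lineB mulrCA mulrC.
have [_ /(_ _ _)ft] := ae_t t01.
have [V JV] := J_neq0 (line x y t).
have [/cvg_ex[l fl] fE] := ft V JV.
have lE : l = V *m (y - x).
  have [_ <-] := is_derive_line x y t.
  by rewrite -fE; apply/esym/cvg_lim.
have l_le : fnorm l <= c by rewrite lE; exact: Jc JV.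
have /nbhs_ballP[d /= d_gt0 dl] : \forall h \near 0^',
    fnorm (l - h^-1 *: ((f \o line x y) (h *: 1 + t) - (f \o line x y) t)) < e.
  by move: e e_gt0; apply/cvg_fnormP.
apply/nbhs_ballP; exists d => // s /= ts.
have [->|st] := eqVneq s t; first by rewrite !subrr normr0 fnorm0 mulr0.
(* The difference quotient is within [e] of [l], hence of norm at most [c + e]. *)
have := dl (s - t); rewrite /ball/= sub0r opprB subr_eq0 => /(_ ts st).
rewrite /GRing.scale/= mulr1 subrK -/(GRing.scale _ _) => lts.
have st_gt0 : 0 < `|s - t| by rewrite normr_gt0 subr_eq0.
rewrite -ler_pdivrMr// mulrC -normfV -fnormZ.
apply: le_trans (fnorm_le_add_dist _ l) _; rewrite lerD// fnorm_distC.
exact: ltW.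
Qed.

End ConservativeMeanValue.

(** * Contractions and set-valued affine fixed points *)

Section ContractionFixpoint.
Context {R : realType} {m n : nat} (rho : R).
Hypotheses (rho_ge0 : 0 <= rho) (rho_lt1 : rho < 1).

Lemma eq0_of_le_mul (x : R) : 0 <= x -> x <= rho * x -> x = 0.
Proof. by move: rho_lt1; nra. Qed.

Lemma cvg_expr_mul (d : R) : rho ^+ k * d @[k --> \oo] --> 0.
Proof.
rewrite -[X in _ --> X](mul0r d); apply: cvgMl; apply: cvg_expr.
by rewrite ger0_norm.
Qed.

Variable G : 'M[R]_(m, n) -> 'M[R]_(m, n).
Hypothesis GL : forall x y, fnorm (G y - G x) <= rho * fnorm (y - x).

Lemma contraction_fixpoint_eq x y : G x = x -> G y = y -> x = y.
Proof.
move=> Gx Gy; apply/subr0_eq/fnorm0_eq0/eq0_of_le_mul; first exact: fnorm_ge0.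
by rewrite -{1}Gx -{1}Gy.
Qed.

(* A minimizer of [fnorm (G x - x)] over an invariant ball is fixed, since
   applying [G] shrinks that quantity. *)
Lemma contraction_fixpoint_ex : exists x, G x = x.
Proof.
(* This radius solves [rho * r + fnorm (G 0) = r], which makes the ball invariant under [G]. *)
pose r := fnorm (G 0) / (1 - rho).
have rho1 : 0 < 1 - rho by rewrite subr_gt0.
have rE : r * (1 - rho) = fnorm (G 0) by rewrite divfK// gt_eqF.
pose K := [set x : 'M[R]_(m, n) | fnorm x <= r].
have K0 : K !=set0.
  by exists 0; rewrite /K/= fnorm0 divr_ge0 ?fnorm_ge0// ltW.
have contG : continuous (fun x => fnorm (G x - x)).
  move=> x; suff Gx : G y - y @[y --> x] --> G x - x.
    apply: (@cvg_comp _ _ _ (fun y => G y - y) (@fnorm R m n) _ _ _ Gx).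
    exact: continuous_fnorm.
  apply/cvg_fnormP; first exact: nbhs_filter.
  move=> e e_gt0; have := near_fnorm_dist x (e := e / 2).
  rewrite divr_gt0// => /(_ isT); apply: filterS => y xy.
  have -> : G x - x - (G y - y) = (G x - G y) - (x - y).
    by rewrite !opprD !opprK addrACA.
  apply: le_lt_trans (fnormD _ _) _; rewrite fnormN.
  by have := GL y x; have := fnorm_ge0 (x - y); move: rho_lt1; nra.
have [c cK cmin] := compact_EVT_min K0 (@compact_fnorm_ball _ _ _ r)
  (continuous_subspaceT contG).
have {}cK : fnorm c <= r by move: cK; rewrite inE.
have GcK : G c \in K.
  rewrite inE /K/=; apply: le_trans (fnorm_le_add_dist _ (G 0)) _.
  have := GL 0 c; rewrite subr0 => Gc; rewrite -rE.
  have : rho * fnorm c <= rho * r by rewrite ler_wpM2l.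
  by lra.
exists c; apply/subr0_eq/fnorm0_eq0/eq0_of_le_mul; first exact: fnorm_ge0.
exact: le_trans (cmin _ GcK) (GL _ _).
Qed.

End ContractionFixpoint.

(** * Affine images of compact sets of matrices and their fixed points *)

Section AffineImage.
Context {R : realType} {p m : nat}.
Implicit Types (J : set 'M[R]_(p, p + m)) (X Y : set 'M[R]_(p, m)).

Lemma affine_imageS J X Y : X `<=` Y -> affine_image J X `<=` affine_image J Y.
Proof.
by move=> XY M [A [B [Z [JAB XZ ->]]]]; exists A, B, Z; split=> //; exact: XY.
Qed.

(** Split the difference as [A (Z - Z') + (A - A') Z' + (B - B')]. The first term is left
    unestimated, so that either the operator norm or the Frobenius norm of [A] can be used on it. *)
Lemma fnorm_affine_dist (A A' : 'M[R]_p) (B B' Z Z' : 'M[R]_(p, m)) (e : R) :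
  fnorm (row_mx A B - row_mx A' B') <= e ->
  fnorm (A *m Z + B - (A' *m Z' + B')) <=
    fnorm (A *m (Z - Z')) + e * (fnorm Z' + 1).
Proof.
rewrite opp_row_mx add_row_mx => Ve.
have -> : A *m Z + B - (A' *m Z' + B') =
    A *m (Z - Z') + ((A - A') *m Z' + (B - B')).
  by rewrite mulmxBr mulmxBl opprD addrACA [RHS]addrA subrKA.
apply: le_trans (fnormD _ _) _; rewrite lerD2l.
apply: le_trans (fnormD _ _) _; rewrite mulrDr mulr1.
apply: lerD; last exact: le_trans (fnorm_row_mxr _ _) Ve.
apply: le_trans (fnorm_mulmx _ _) _; rewrite ler_wpM2r ?fnorm_ge0//.
exact: le_trans (fnorm_row_mxl _ _) Ve.
Qed.

(** The affine image is the image of the compact product [J] x [X] under a continuous map. *)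
Lemma compact_affine_image J X :
  compact J -> compact X -> compact (affine_image J X).
Proof.
move=> cJ cX.
pose f (VZ : 'M[R]_(p, p + m) * 'M[R]_(p, m)) :=
  lsubmx VZ.1 *m VZ.2 + rsubmx VZ.1.
have -> : affine_image J X = f @` (J `*` X).
  apply/seteqP; split=> [M [A [B [Z [JAB XZ ->]]]]|_ [[V Z] [/= JV XZ] <-]].
    by exists (row_mx A B, Z); rewrite // /f /= row_mxKl row_mxKr.
  by exists (lsubmx V), (rsubmx V), Z; rewrite hsubmxK.
apply: continuous_compact; last exact: compact_setX.
apply: continuous_subspaceT => -[V Z]; apply/cvg_fnormP => e e_gt0.
(* Since [d <= 1] gives [fnorm Z' <= fnorm Z + 1], the total error is below
   [d * (fnorm V + fnorm Z + 2)], that is [d * c <= e]. *)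
pose c := fnorm V + fnorm Z + 2.
have c_gt0 : 0 < c by rewrite ltr_wpDl// addr_ge0 ?fnorm_ge0.
pose d := Num.min 1 (e / c).
have d_gt0 : 0 < d by rewrite lt_min ltr01 divr_gt0.
exists ([set V' | fnorm (V - V') < d], [set Z' | fnorm (Z - Z') < d]).
  by split; exact: near_fnorm_dist.
move=> [V' Z'] [/= VV' ZZ']; rewrite /f /=.
have := @fnorm_affine_dist (lsubmx V) (lsubmx V') (rsubmx V) (rsubmx V') Z Z'
  (fnorm (V - V')).
rewrite !hsubmxK => /(_ (lexx _))/le_lt_trans; apply.
have := fnorm_mulmx (lsubmx V) (Z - Z').
have : fnorm (lsubmx V) <= fnorm V.
  by rewrite -[in leRHS](hsubmxK V) fnorm_row_mxl.
have := fnorm_le_add_dist Z' Z; rewrite (fnorm_distC Z').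
have : d <= 1 by rewrite ge_min lexx.
have : d * c <= e by rewrite -ler_pdivlMr// ge_min lexx orbT.
rewrite /c.
move: (fnorm_ge0 V) (fnorm_ge0 Z) (fnorm_ge0 (Z - Z')) (fnorm_ge0 (V - V')).
move=> V0 Z0 ZZ0 VV0 dc d1 Z'le Vl Mle.
have h1 : fnorm (lsubmx V) * fnorm (Z - Z') <= fnorm V * fnorm (Z - Z').
  by rewrite ler_wpM2r.
have h2 : fnorm V * fnorm (Z - Z') <= fnorm V * d by rewrite ler_wpM2l// ltW.
have h3 : fnorm (V - V') * (fnorm Z' + 1) <= fnorm (V - V') * (fnorm Z + 2).
  by rewrite ler_wpM2l//; lra.
have h4 : fnorm (V - V') * (fnorm Z + 2) < d * (fnorm Z + 2).
  by rewrite ltr_pM2r//; lra.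
by nra.
Qed.

Definition op_bounded (c : R) J := forall A B, J (row_mx A B) -> opnorm A <= c.

Context {rho : R}.
Hypotheses (rho_ge0 : 0 <= rho) (rho_lt1 : rho < 1).

(** One step of the error recursion, with [J'] a perturbation of [J]: the contraction by [rho] comes
    from the blocks of [J'], the error term from replacing an element of [J'] by a nearby one of
    [J]. It is used with [e = 0] for uniqueness and with small [e] for the iterates. *)
Lemma affine_image_dist (J J' : set 'M[R]_(p, p + m)) X Y (d e r : R) :
  op_bounded rho J' -> 0 <= e ->
  (forall V, J' V -> exists2 V', J V' & fnorm (V - V') <= e) ->
  (forall Z, Y Z -> fnorm Z <= r) ->
  affine_image J Y `<=` Y ->
  (forall Z, X Z -> exists2 Z', Y Z' & fnorm (Z - Z') <= d) ->
  forall Z, affine_image J' X Z ->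
    exists2 Z', Y Z' & fnorm (Z - Z') <= rho * d + e * (r + 1).
Proof.
move=> J'rho e_ge0 J'J Yr JY XY _ [A [B [Z [J'AB XZ ->]]]].
have [V' JV' VV'] := J'J _ J'AB.
have [Z' YZ' ZZ'] := XY _ XZ.
move: JV' VV'; rewrite -(hsubmxK V') => JV' VV'.
exists (lsubmx V' *m Z' + rsubmx V').
  by apply: JY; exists (lsubmx V'), (rsubmx V'), Z'.
apply: le_trans (fnorm_affine_dist _ _ VV') _; apply: lerD.
  apply: le_trans (fnorm_mul_le _ (J'rho _ _ J'AB)) _.
  by rewrite ler_wpM2l.
by rewrite ler_wpM2l// lerD2r Yr.
Qed.

(** A point of [X] can be traced back [k] steps inside [X]; replaying these steps from a point of
    [Y] stays in [Y] and ends within [rho ^+ k * (rX + rY)]. Since [Y] is closed, the limit gives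
    the inclusion. *)
Lemma affine_invariant_sub J X Y :
  op_bounded rho J -> compact X -> compact Y -> Y !=set0 ->
  X `<=` affine_image J X -> affine_image J Y `<=` Y -> X `<=` Y.
Proof.
move=> Jrho cX cY [Y0 YY0] XJ JY.
have [rX Xr] := compact_fnorm_bounded cX.
have [rY Yr] := compact_fnorm_bounded cY.
have dist k Z : X Z ->
    exists2 Z', Y Z' & fnorm (Z - Z') <= rho ^+ k * (rX + rY).
  elim: k Z => [|k IH] Z XZ.
    exists Y0 => //; rewrite expr0 mul1r; apply: le_trans (fnormD _ _) _.
    by rewrite fnormN lerD// ?Xr ?Yr.
  have JJ V : J V -> exists2 V', J V' & fnorm (V - V') <= 0.
    by exists V; rewrite // subrr fnorm0.
  have [Z' YZ' ZZ'] := affine_image_dist Jrho (lexx 0) JJ Yr JY IH (XJ _ XZ).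
  by exists Z' => //; move: ZZ'; rewrite mul0r addr0 mulrA -exprS.
move=> Z XZ; have -> : Y = closure Y.
  by apply/closure_id; apply: compact_closed cY; exact: norm_hausdorff.
move=> U /fnorm_nbhsP[e e_gt0 eU].
have [k ke] : exists k, rho ^+ k * (rX + rY) < e.
  have := cvg_expr_mul rho_ge0 rho_lt1 (rX + rY).
  move=> /cvgrPdist_lt/(_ _ e_gt0)[k _ /(_ k (leqnn k))].
  by rewrite sub0r normrN => /(le_lt_trans (ler_norm _)); exists k.
have [Z' YZ' ZZ'] := dist k Z XZ.
by exists Z'; split=> //; apply: eU; exact: le_lt_trans ke.
Qed.

Lemma affine_invariant_compact_ex J : op_bounded rho J -> compact J -> J !=set0 ->
  exists X, [/\ X !=set0, compact X & X = affine_image J X].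
Proof.
move=> Jrho cJ [V0 JV0].
have [r0 Jr0] := compact_fnorm_bounded cJ.
have rho1 : 0 < 1 - rho by rewrite subr_gt0.
(* Solves [rho * r + r0 = r], so the ball [K] is stable under [affine_image J]. *)
pose r := r0 / (1 - rho).
have rE : r * (1 - rho) = r0 by rewrite divfK// gt_eqF.
pose K := [set Z : 'M[R]_(p, m) | fnorm Z <= r].
have affine_le A B Z : J (row_mx A B) ->
    fnorm (A *m Z + B) <= rho * fnorm Z + r0.
  move=> JAB; apply: le_trans (fnormD _ _) _; apply: lerD.
    exact: fnorm_mul_le (Jrho _ _ JAB).
  exact: le_trans (fnorm_row_mxr _ _) (Jr0 _ JAB).
have JK : affine_image J K `<=` K.
  move=> _ [A [B [Z [/affine_le JAB KZ ->]]]]; apply: le_trans (JAB _) _.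
  have : rho * fnorm Z <= rho * r by rewrite ler_wpM2l.
  by rewrite -rE; lra.
(* The largest subset of the ball contained in its own image
   (Knaster-Tarski); it is compact because its closure has that property. *)
pose X := \bigcup_(Z in [set Z | Z `<=` K /\ Z `<=` affine_image J Z]) Z.
have XK : X `<=` K by move=> M [Z [ZK _]]; exact: ZK.
have subX Z : Z `<=` K -> Z `<=` affine_image J Z -> Z `<=` X.
  by move=> ZK ZJ M ZM; exists Z.
have XJ : X `<=` affine_image J X.
  move=> M [Z [ZK ZJ] ZM].
  exact: affine_imageS (subX _ ZK ZJ) _ (ZJ _ ZM).
(* The image of [X] is itself a competitor: it lies in [K] by stability and in its own image by
   monotonicity. *)
have JX : affine_image J X `<=` X.
  apply: subX (affine_imageS XJ).
  exact: subset_trans (affine_imageS XK) JK.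
have clK : closed K.
  by apply: compact_closed; [exact: norm_hausdorff|exact: compact_fnorm_ball].
have clXK : closure X `<=` K.
  by rewrite (iffLR (closure_id K) clK); exact: closure_subset.
have cclX : compact (closure X).
  apply: compact_of_fnorm_bounded clXK; exact: closed_closure.
have clX : closure X `<=` X.
  apply: subX clXK _.
  (* The image of the compact set [closure X] is closed and contains [X], hence contains
     [closure X]. *)
  have cJX := compact_affine_image cJ cclX.
  have /closure_id -> : closed (affine_image J (closure X)).
    by apply: compact_closed cJX; exact: norm_hausdorff.
  apply: closure_subset; apply: subset_trans XJ _.
  by apply: affine_imageS; exact: subset_closure.
exists X; split.
(* Nonemptiness: the fixed point of the single affine contraction given by [V0] yields a singleton
   contained in its own image. *)
- have [|Z ZE] := @contraction_fixpoint_ex R p m rho rho_ge0 rho_lt1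
      (fun Z => lsubmx V0 *m Z + rsubmx V0).
    move=> y z; rewrite opprD addrACA subrr addr0 -mulmxBr.
    by apply: fnorm_mul_le; apply: (Jrho _ (rsubmx V0)); rewrite hsubmxK.
  exists Z; apply: (subX [set Z]) => // _ ->; last first.
    by exists (lsubmx V0), (rsubmx V0), Z; rewrite hsubmxK.
  rewrite /K/=; have := affine_le (lsubmx V0) (rsubmx V0) Z.
  rewrite hsubmxK ZE => /(_ JV0) Zle.
  by rewrite -(ler_pM2r rho1) rE; lra.
- rewrite -(_ : closure X = X)//; apply/seteqP; split=> //.
  exact: subset_closure.
- by apply/seteqP; split.
Qed.

(** Uniqueness, by [affine_invariant_sub] in both directions, ensures that [the] returns the
    invariant set and not its default [set0]. *)
Lemma setfixP J : op_bounded rho J -> compact J -> J !=set0 ->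
  [/\ setfix J !=set0, compact (setfix J)
    & setfix J = affine_image J (setfix J)].
Proof.
move=> Jrho cJ J0; have [X XP] := affine_invariant_compact_ex Jrho cJ J0.
pose P (X : set 'M[R]_(p, m)) :=
  [/\ X !=set0, compact X & X = affine_image J X].
have uX : unique P X.
  split=> // Y [Y0 cY YJ]; have [X0 cX XJ] := XP.
  by apply/seteqP; split; apply: (affine_invariant_sub Jrho) => //;
    rewrite -?XJ -?YJ.
by have [] := xgetPex set0 (ex_intro [set X | unique P X] X uX).
Qed.

End AffineImage.

(** * Jacobians of the iterates *)

Section ClosedGraph.
Context {R : realType} {n q : nat} (f : 'cV[R]_n -> 'cV[R]_q).
Context (J : 'cV[R]_n -> set 'M[R]_(q, n)).
Hypothesis fJ : conservative_jacobian f J.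

Lemma conservative_jacobian_bounded x :
  exists r : R, forall V, J x V -> fnorm V <= r.
Proof.
by have [_ /(_ x)[r xr] _ _] := fJ; exists r; exact: nbhs_singleton xr.
Qed.

Lemma conservative_jacobian_compact x : compact (J x).
Proof.
have [clJ _ _ _] := fJ; have [r Jr] := conservative_jacobian_bounded x.
apply: compact_of_fnorm_bounded Jr.
apply: (@closed_comp _ _ (pair x) [set z | J z.1 z.2]) => // V _.
move=> U [[A B] [/= xA VB] AB]; apply: filterS VB => W BW.
by apply: AB; split=> //; exact: nbhs_singleton xA.
Qed.

(** Local boundedness puts all [J y], for [y] near [x], in one compact ball, so a local check around
    each [V] of the ball suffices. *)
Lemma conservative_jacobian_usc (x : 'cV[R]_n) (e : R) : 0 < e ->
  \forall y \near x, forall V, J y V ->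
    exists2 V', J x V' & fnorm (V - V') <= e.
Proof.
move=> e_gt0; have [clJ /(_ x)[r xr] _ _] := fJ.
have /compact_near_coveringP cK := @compact_fnorm_ball R q n r.
pose P y V := J y V -> exists2 V', J x V' & fnorm (V - V') <= e.
have : \forall y \near x, [set V | fnorm V <= r] `<=` P y.
  apply: (cK _ (nbhs x) P) => V _.
  (* If [J x V], then [V] itself is the nearby element; otherwise the complement of the closed graph
     is a neighbourhood of [(x, V)] and the claim is vacuous there. *)
  have [JV|nJV] := pselect (J x V).
    exists ([set V' | fnorm (V - V') < e], setT) => /=.
      by split; [exact: near_fnorm_dist|exact: filterT].
    move=> [V' y] [/= VV' _] _; exists V => //.
    by rewrite fnorm_distC ltW.
  have : nbhs (x, V) (~` [set z : 'cV[R]_n * 'M[R]_(q, n) | J z.1 z.2]).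
    by apply: open_nbhs_nbhs; split=> //; exact: closed_openC.
  move=> [[A B] [/= xA VB] AB]; exists (B, A) => //= -[V' y] [/= BV' Ay] JyV'.
  by have := AB (y, V') (conj Ay BV') JyV'.
move=> near_cover; near=> y => V JV.
by apply: (near near_cover y) => //=; apply: (near xr y).
Unshelve. all: by end_near. Qed.

End ClosedGraph.

(** * Convergence of the iterates and of their Jacobians *)

Section IterateJacobians.
Context {R : realType} {p m : nat} (F : 'cV[R]_(p + m) -> 'cV[R]_p).
Context (JF : 'cV[R]_(p + m) -> set 'M[R]_(p, p + m)) (rho : R).
Hypotheses (F_lip : locally_lipschitz F) (F_jac : conservative_jacobian F JF).
Hypotheses (rho_ge0 : 0 <= rho) (rho_lt1 : rho < 1).
Hypothesis JF_le : forall x theta, op_bounded rho (JF (col_mx x theta)).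

(** With [theta] fixed the direction is [col_mx (y - x) 0], on which only the block [A] of [[A, B]]
    acts. *)
Lemma partial_contraction theta x y :
  fnorm (F (col_mx y theta) - F (col_mx x theta)) <= rho * fnorm (y - x).
Proof.
have sub : col_mx y theta - col_mx x theta = col_mx (y - x) 0.
  by rewrite opp_col_mx add_col_mx subrr.
apply: conservative_mean_value F_lip F_jac _ _.
  by rewrite mulr_ge0// fnorm_ge0.
move=> t V; rewrite sub scale_col_mx scaler0 add_col_mx addr0.
rewrite -(hsubmxK V) => /JF_le V_le.
by rewrite mul_row_col mulmx0 addr0; exact: fnorm_mul_le.
Qed.

Lemma fixpointP theta : F (col_mx (fixpoint F theta) theta) = fixpoint F theta.
Proof.
have Fc := partial_contraction theta.
have [x Fx] := contraction_fixpoint_ex rho_ge0 rho_lt1 Fc.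
pose P x := F (col_mx x theta) = x.
have ux : unique P x.
  split=> // y Fy.
  exact: (contraction_fixpoint_eq rho_lt1 Fc).
by have [] := xgetPex 0 (ex_intro [set x | unique P x] x ux).
Qed.

Lemma iterate_dist (x0 : 'cV[R]_m -> 'cV[R]_p) theta k :
  fnorm (iterate F x0 k theta - fixpoint F theta) <=
    rho ^+ k * fnorm (x0 theta - fixpoint F theta).
Proof.
elim: k => [|k IH] /=; first by rewrite mul1r.
rewrite -{1}fixpointP exprS -mulrA.
by apply: le_trans (partial_contraction _ _ _) _; rewrite ler_wpM2l.
Qed.

Lemma near_JF_iterate (x0 : 'cV[R]_m -> 'cV[R]_p) theta (e : R) : 0 < e ->
  \forall k \near \oo, forall V, JF (col_mx (iterate F x0 k theta) theta) V ->
    exists2 V', JF (col_mx (fixpoint F theta) theta) V' & fnorm (V - V') <= e.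
Proof.
move=> e_gt0.
have /fnorm_nbhsP[d d_gt0 dJ] :=
  conservative_jacobian_usc F_jac (col_mx (fixpoint F theta) theta) e_gt0.
have := cvg_expr_mul rho_ge0 rho_lt1 (fnorm (x0 theta - fixpoint F theta)).
move=> /cvgrPdist_lt/(_ _ d_gt0); apply: filterS => k.
rewrite sub0r normrN => /(le_lt_trans (ler_norm _)) kd; apply: dJ.
rewrite opp_col_mx add_col_mx subrr fnorm_col_mx0 fnorm_distC.
exact: le_lt_trans (iterate_dist _ _ _) kd.
Qed.

Context (x0 : 'cV[R]_m -> 'cV[R]_p) (Jx0 : 'cV[R]_m -> set 'M[R]_(p, m)).
Hypothesis x0_jac : conservative_jacobian x0 Jx0.

Lemma iterate_jacobian_nonempty theta k :
  iterate_jacobian F JF x0 Jx0 k theta !=set0.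
Proof.
elim: k => [|k [Z JZ]] /=; first by have [_ _ /(_ theta)] := x0_jac.
have [_ _ /(_ (col_mx (iterate F x0 k theta) theta))[V JV] _] := F_jac.
exists (lsubmx V *m Z + rsubmx V), (lsubmx V), (rsubmx V), Z.
by rewrite hsubmxK.
Qed.

(** The bound may depend on [k]; it supplies the initial distance of the error recursion at one
    fixed rank. *)
Lemma iterate_jacobian_bounded theta k :
  exists r : R,
    forall Z, iterate_jacobian F JF x0 Jx0 k theta Z -> fnorm Z <= r.
Proof.
elim: k => [|k [r Jr]] /=; first exact: conservative_jacobian_bounded x0_jac _.
have [s Js] :=
  conservative_jacobian_bounded F_jac (col_mx (iterate F x0 k theta) theta).
exists (s * r + s) => _ [A [B [Z [/Js sAB /Jr rZ ->]]]].
apply: le_trans (fnormD _ _) _; apply: lerD; last first.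
  exact: le_trans (fnorm_row_mxr _ _) sAB.
apply: le_trans (fnorm_mulmx _ _) _; apply: ler_pM; rewrite ?fnorm_ge0//.
exact: le_trans (fnorm_row_mxl _ _) sAB.
Qed.

Lemma gap_iterate_jacobian_near theta (e : R) : 0 < e ->
  \forall k \near \oo, (gap (iterate_jacobian F JF x0 Jx0 k theta)
      (setfix (JF (col_mx (fixpoint F theta) theta))) <= e%:E)%E.
Proof.
move=> e_gt0; set J := JF _; set X := setfix J.
have Jrho : op_bounded rho J by exact: JF_le.
have J0 : J !=set0.
  by have [_ _ /(_ (col_mx (fixpoint F theta) theta))] := F_jac.
have cJ : compact J by exact: conservative_jacobian_compact F_jac _.
have [[X1 XX1] cX XE] := setfixP rho_ge0 rho_lt1 Jrho cJ J0.
have [r Xr] := compact_fnorm_bounded cX.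
have r_ge0 : 0 <= r by exact: le_trans (fnorm_ge0 X1) (Xr _ XX1).
have rho1 : 0 < 1 - rho by rewrite subr_gt0.
(* Makes [e / 2] the fixed point of the recursion [d |-> rho * d + e1 * (r + 1)]. *)
pose e1 := e * (1 - rho) / (2 * (r + 1)).
have e1_gt0 : 0 < e1 by rewrite divr_gt0 ?mulr_gt0// ltr_wpDl.
have e1E : e1 * (r + 1) = e / 2 * (1 - rho).
  by rewrite /e1; field; rewrite gt_eqF// ltr_wpDl.
have [K _ KJ] := near_JF_iterate x0 theta e1_gt0.
have [s Js] := iterate_jacobian_bounded theta K.
pose d := s + r.
(* The recursion starts at rank [K], from which the Jacobians of [F] are within [e1] of [J]. *)
have dist k Z : iterate_jacobian F JF x0 Jx0 (k + K) theta Z ->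
    exists2 Z', X Z' & fnorm (Z - Z') <= rho ^+ k * d + e / 2.
  elim: k Z => [|k IH] Z JZ.
    exists X1 => //; rewrite expr0 mul1r; apply: le_trans (fnormD _ _) _.
    rewrite fnormN; have := Js _ JZ; have := Xr _ XX1.
    by rewrite /d; lra.
  have JX : affine_image J X `<=` X by rewrite -XE.
  have JJ := KJ _ (leq_addl k K).
  have [Z' XZ' ZZ'] := affine_image_dist rho_ge0 (@JF_le _ _) (ltW e1_gt0)
    JJ Xr JX IH JZ.
  exists Z' => //; apply: le_trans ZZ' _; rewrite exprS e1E.
  by lra.
have := cvg_expr_mul rho_ge0 rho_lt1 d.
move=> /cvgrPdist_lt/(_ (e / 2)); rewrite divr_gt0// => /(_ isT)[N _ Ne].
exists (N + K)%N => // k /= Nk.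
have kK : (K <= k)%N by exact: leq_trans (leq_addl _ _) Nk.
apply: ge_ereal_sup => _ [Z JZ <-].
move: JZ; rewrite -(subnK kK) => /dist[Z' XZ' ZZ'].
apply: le_trans (ereal_inf_lbound _) _; first by exists Z'.
rewrite lee_fin; apply: le_trans ZZ' _.
have := Ne (k - K)%N; rewrite /= leq_subRL// addnC => /(_ Nk).
rewrite sub0r normrN => /(le_lt_trans (ler_norm _)).
by lra.
Qed.

(** Nonemptiness of [X] matters: the supremum over an empty set would be [-oo]. *)
Lemma gap_ge0 (n q : nat) (X Y : set 'M[R]_(n, q)) :
  X !=set0 -> (0 <= gap X Y)%E.
Proof.
move=> [M XM]; apply: le_trans (ereal_sup_ubound _); last by exists M.
by apply: le_ereal_inf_tmp => _ [N _ <-]; rewrite lee_fin fnorm_ge0.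
Qed.

End IterateJacobians.

Theorem corollary1 (R : realType) (p m : nat)
  (F : 'cV[R]_(p + m) -> 'cV[R]_p)
  (JF : 'cV[R]_(p + m) -> set 'M[R]_(p, p + m))
  (rho : R)
  (x0 : 'cV[R]_m -> 'cV[R]_p)
  (Jx0 : 'cV[R]_m -> set 'M[R]_(p, m))
  (F_lip : locally_lipschitz F)
  (F_pd : path_differentiable F)
  (F_jac : conservative_jacobian F JF)
  (rho_ge0 : 0 <= rho) (rho_lt1 : rho < 1)
  (JF_le : forall (x : 'cV[R]_p) (theta : 'cV[R]_m)
             (A : 'M[R]_p) (B : 'M[R]_(p, m)),
      JF (col_mx x theta) (row_mx A B) -> opnorm A <= rho)
  (x0_lip : lipschitz x0)
  (x0_pd : path_differentiable x0)
  (x0_jac : conservative_jacobian x0 Jx0)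
  (theta : 'cV[R]_m) :
  gap (iterate_jacobian F JF x0 Jx0 k theta)
      (setfix (JF (col_mx (fixpoint F theta) theta)))
    @[k --> \oo] --> 0%E.
Proof.
move=> U U0; have /nbhs_ballP[e /= e_gt0 eU] : nbhs (0 : R) (U \o EFin) by [].
have e2_gt0 : 0 < e / 2 by rewrite divr_gt0.
have := gap_iterate_jacobian_near F_lip F_jac rho_ge0 rho_lt1 JF_le x0_jac theta
  e2_gt0.
apply: filterS => k.
have := gap_ge0 (setfix (JF (col_mx (fixpoint F theta) theta)))
  (iterate_jacobian_nonempty F_jac x0_jac theta k).
(* The bounds 0 and [e / 2] exclude both infinite values of the gap. *)
rewrite /preimage/=; case: gap => [r| |] //; rewrite !lee_fin => r_ge0 re.
by apply: (eU r); rewrite /ball/= sub0r normrN ger0_norm//; lra.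
Qed.
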